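(* Let $\Sigma$ be a mixing shift of finite type on a finite alphabet $S$, and let $m$ be its unique measure of maximal entropy. Then there exists a constant $M>0$ such that for all $\phi\in\Omega^{\mathsf H}$, the topological pressure satisfies $$P(t\phi)\le h_{\mathrm{top}}(\Sigma)+t\int_\Sigma\phi\,dm+Mt^2\quad\text{for all } t\in\mathbb{R}.$$
   Context: $\mathbb{N}=\{1,2,\dots\}$, $S$ is a finite set, $S^{\mathbb{N}}$ carries the product topology, and the shift is $\sigma(x)_n=x_{n+1}$. A shift of finite type (SFT) is a set $\Sigma=\{x\in S^{\mathbb{N}}: A(x_n,x_{n+1})=1 \text{ for all } n\in\mathbb{N}\}$ for a transition matrix $A:S\times S\to\{0,1\}$. It is mixing if some power $A^n$, $n\in\mathbb{N}$, has all entries positive. For a word $w\in S^n$, $[w]=\{x\in\Sigma: x_1\cdots x_n=w\}$; $\mathcal{L}_n=\{w\in S^n:[w]\ne\emptyset\}$. The topological entropy is $h_{\mathrm{top}}(\Sigma)=\lim_{n\to\infty}\frac1n\log\#\mathcal{L}_n$. For continuous $\phi:\Sigma\to\mathbb{R}$, the topological pressure is $$P(\phi)=\lim_{n\to\infty}\frac1n\log\sum_{w\in\mathcal{L}_n}e^{\sup\{\mathsf{S}_n\phi(x):x\in[w]\}},\qquad \mathsf{S}_n\phi(x)=\sum_{j=0}^{n-1}\phi(\sigma^jx).$$ For a shift-invariant Borel probability measure $\mu$ on $\Sigma$, the entropy is $h(\mu)=\lim_{n\to\infty}\frac1n\sum_{w\in S^n}-\mu([w])\log\mu([w])$ with $0\log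 0=0$. A measure of maximal entropy is a shift-invariant Borel probability measure $m$ on $\Sigma$ with $h(m)=h_{\mathrm{top}}(\Sigma)$; a mixing SFT has exactly one. For $n\in\mathbb{N}$ and $x,y\in\Sigma$ let $d^{\mathsf H}_n(x,y)=\frac1n\#\{i\in\{1,\dots,n\}: x_i\ne y_i\}$. $\Omega^{\mathsf H}_n$ is the set of functions $\phi:\Sigma\to\mathbb{R}$ with $|\phi(x)-\phi(y)|\le d^{\mathsf H}_n(x,y)$ for all $x,y\in\Sigma$, and $\Omega^{\mathsf H}=\bigcup_{n\in\mathbb{N}}\Omega^{\mathsf H}_n$ (its elements are continuous). *)

(* Defs.v *)
From HB Require Import structures.
From mathcomp Require Import all_boot all_order all_algebra.
From mathcomp Require Import all_classical all_reals all_analysis.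

Set Implicit Arguments.
Unset Strict Implicit.
Unset Printing Implicit Defensive.

Import Order.TTheory GRing.Theory Num.Theory.
Import numFieldNormedType.Exports.

Local Open Scope classical_set_scope.
Local Open Scope ring_scope.

(* Sequences are indexed from 0: the coordinate written x_n, n = 1, 2, ..., in
   the usual one-sided notation is here x n.-1. *)

(* S^N with the product of the discrete topologies.  The letter s0 is a
   phantom parameter: it only provides the default point that measurableType
   requires. *)
Definition seq_space (S : finType) (s0 : S) : Type :=
  prod_topology (fun _ : nat => discrete_topology S).

HB.instance Definition _ (S : finType) (s0 : S) :=
  Topological.copy (seq_space s0)
    (prod_topology (fun _ : nat => discrete_topology S)).
HB.instance Definition _ (S : finType) (s0 : S) :=
  isPointed.Build (seq_space s0) (fun=> s0).

Definition borel_seq (S : finType) (s0 : S) :=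
  g_sigma_algebraType (@open (seq_space s0)).

Section ShiftOfFiniteType.
Variables (S : finType) (A : rel S).

Definition shift (x : nat -> S) : nat -> S := fun n => x n.+1.

Definition sft : set (nat -> S) := [set x | forall n, A (x n) (x n.+1)].

Definition transition_mx : 'M[nat]_#|S| :=
  \matrix_(i, j) (A (enum_val i) (enum_val j) : nat).

Definition mixing_sft : Prop :=
  exists n, (0 < n)%N /\ forall i j, (0 < (transition_mx ^+ n) i j)%N.

Definition cylinder n (w : n.-tuple S) : set (nat -> S) :=
  [set x | sft x /\ forall i : 'I_n, x i = tnth w i].

Definition language n : {set n.-tuple S} :=
  [set w : n.-tuple S | `[< cylinder w !=set0 >]]%SET.

Variable R : realType.

Definition htop : R :=
  lim ((fun n : nat => n%:R^-1 * ln (#|language n|%:R : R)) @ \oo).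

Definition birkhoff_sum (phi : (nat -> S) -> R) (n : nat) (x : nat -> S) : R :=
  \sum_(0 <= j < n) phi (iter j shift x).

Definition pressure (phi : (nat -> S) -> R) : R :=
  lim ((fun n : nat => n%:R^-1 *
    ln (\sum_(w in language n)
          expR (sup (birkhoff_sum phi n @` cylinder w)))) @ \oo).

Definition hamming_dist (n : nat) (x y : nat -> S) : R :=
  n%:R^-1 * #|[set i : 'I_n | x i != y i]%SET|%:R.

(* A function on sft is represented by a function on all sequences; only its
   values on sft are constrained here, and only they enter pressure and
   integrals over sft. *)
Definition Omega_n (n : nat) : set ((nat -> S) -> R) :=
  [set phi | forall x y, sft x -> sft y ->
               `|phi x - phi y| <= hamming_dist n x y].

Definition Omega : set ((nat -> S) -> R) :=
  \bigcup_(n in [set n | (0 < n)%N]) Omega_n n.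

Variable s0 : S.

(* A Borel probability measure on sft is encoded as one on the full sequence
   space giving sft full mass. *)
Definition invariant_on_sft (mu : probability (borel_seq s0) R) : Prop :=
  mu sft = 1%E /\
  forall B : set (borel_seq s0), measurable B -> mu (shift @^-1` B) = mu B.

(* ln 0 = 0 in the library, so words of measure zero contribute 0. *)
Definition entropy (mu : probability (borel_seq s0) R) : R :=
  lim ((fun n : nat => n%:R^-1 *
    \sum_(w : n.-tuple S)
       - (fine (mu (cylinder w)) * ln (fine (mu (cylinder w))))) @ \oo).

Definition max_entropy_measure (mu : probability (borel_seq s0) R) : Prop :=
  invariant_on_sft mu /\ entropy mu = htop.

End ShiftOfFiniteType.

Arguments htop {S} A R.

(* Main.v *)
Require Import Defs.
From HB Require Import structures.
From mathcomp Require Import all_boot all_order all_algebra.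
From mathcomp Require Import ring lra.
From mathcomp Require Import all_classical all_reals all_analysis.

Set Implicit Arguments.
Unset Strict Implicit.
Unset Printing Implicit Defensive.

Import Order.TTheory GRing.Theory Num.Theory.
Import numFieldNormedType.Exports.

Local Open Scope classical_set_scope.
Local Open Scope ring_scope.

(* Azuma-type concentration, applied to uniformly distributed admissible words
   rather than to [m].  By mixing, the laws of uniform paths of the same length
   from two states share a common part after a fixed number of steps (Doeblin),
   so the means of a Hamming-Lipschitz function of the path differ by at most a
   constant depending on the shift only.  Revealing the letters one at a time
   then gives
     log Z_N(t) <= log #L_N + t c_N + C t^2 N + O(1),
   where Z_N(t) is the partition sum of [t phi] and c_N a mean value of the
   Birkhoff sum of [phi].  In the other direction, the Gibbs inequality for [m]
   gives H_N(m) + s N int phi dm <= log Z_N(s).  Taking s = - t and combining,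
   t c_N is at most t N int phi dm + C t^2 N + (log #L_N - H_N(m)) + O(1), and
   the last difference is o(N) because [m] has maximal entropy; hence M = 2 C.
   Only the entropy of [m] enters, so uniqueness of [m] is not used, and the
   limits exist by Fekete's lemma. *)

(** * Finite averages *)

Section FiniteAverages.
Context {R : realType} {I : finType}.
Implicit Types (P Q q nu g : I -> R).

(** Keeping [x] outside the exponential lets it vanish when a centred variable is averaged, which
    leaves a Gaussian factor. Above 1/2 one has x <= 2x^2; below -1/2 the left side is at most 1; in
    between it is at most 1/(1-x). *)
Lemma expR_le_id_add_expR_sqr (x : R) : expR x <= x + expR (2 * x ^+ 2).
Proof.
have e2 : 1 + 2 * x ^+ 2 <= expR (2 * x ^+ 2) := expR_ge1Dx _.
have [x_small|x_big] := lerP x (2^-1); last first.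
  have : expR x <= expR (2 * x ^+ 2) by rewrite ler_expR; nra.
  by lra.
have [x_neg|x_nneg] := lerP x (- 2^-1).
  have : expR x <= 1 by rewrite expR_le1; lra.
  by nra.
have inv1 : expR x * (1 - x) <= 1.
  rewrite -[leRHS](expRxMexpNx_1 x) ler_wpM2l ?expR_ge0//.
  exact: expR_ge1Dx.
suff : expR x <= 1 + x + 2 * x ^+ 2 by lra.
rewrite -(@ler_pM2r _ (1 - x)); last by lra.
apply: le_trans inv1 _; nra.
Qed.

(** Hoeffding's lemma with a cruder constant: every [g i] lies within [D] of the mean, and the
    linear term of the previous bound averages to zero. *)
Lemma exp_moment_le q g (D t : R) :
  (forall i, 0 <= q i) -> \sum_i q i = 1 ->
  (forall i j, `|g i - g j| <= D) ->
  \sum_i q i * expR (t * g i) <=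
    expR (t * (\sum_i q i * g i) + 2 * t ^+ 2 * D ^+ 2).
Proof.
move=> q0 q1 gD; set c := \sum_i q i * g i.
have gc i : `|g i - c| <= D.
  have -> : g i - c = \sum_j q j * (g i - g j).
    under eq_bigr do rewrite mulrBr.
    by rewrite sumrB -mulr_suml q1 mul1r.
  apply: le_trans (ler_norm_sum _ _ _) _.
  rewrite -[leRHS]mul1r -q1 mulr_suml; apply: ler_sum => j _.
  by rewrite normrM ger0_norm// ler_wpM2l.
have -> : \sum_i q i * expR (t * g i) =
    expR (t * c) * \sum_i q i * expR (t * (g i - c)).
  rewrite mulr_sumr; apply: eq_bigr => i _.
  by rewrite mulrCA -expRD; congr (_ * expR _); ring.
rewrite expRD ler_wpM2l ?expR_ge0//.
(* The inserted linear term has mean zero, so the two averages can be compared term by term. *)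
have -> : expR (2 * t ^+ 2 * D ^+ 2) =
    \sum_i q i * (t * (g i - c) + expR (2 * t ^+ 2 * D ^+ 2)).
  under eq_bigr do rewrite mulrDr.
  rewrite big_split/= -mulr_suml q1 mul1r.
  under eq_bigr do rewrite mulrCA mulrBr.
  by rewrite -mulr_sumr sumrB -mulr_suml q1 mul1r subrr mulr0 add0r.
apply: ler_sum => i _; rewrite ler_wpM2l//.
apply: le_trans (expR_le_id_add_expR_sqr _) _.
rewrite lerD2l ler_expR exprMn mulrA ler_wpM2l ?(mulr_ge0 _ (sqr_ge0 t))//.
by rewrite -(real_normK (num_real (g i - c))) ler_sqr ?nnegrE// (le_trans _ (gc i)).
Qed.

(** The common part [d * nu] cancels in the difference. Each remainder is nonnegative of mass
    [1 - d], so it averages [g] to between [1 - d] times the minimum of [g] and [1 - d] times that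
    minimum plus [D]. *)
Lemma doeblin_contraction P Q nu g (d D : R) : 0 <= d ->
  (forall i, d * nu i <= P i) -> (forall i, d * nu i <= Q i) ->
  \sum_i P i = 1 -> \sum_i Q i = 1 -> \sum_i nu i = 1 ->
  (forall i j, g i - g j <= D) ->
  \sum_i P i * g i - \sum_i Q i * g i <= (1 - d) * D.
Proof.
move=> d0 Pnu Qnu P1 Q1 nu1 gD.
have [i0 _|I0] := pickP (xpredT : pred I); last first.
  by move: nu1; rewrite big1 => [/eqP|i]; [rewrite eq_sym oner_eq0|have := I0 i].
pose k := [arg min_(i < i0) g i]%O.
have gk i : g k <= g i.
  by rewrite /k; case: Order.TotalTheory.arg_minP => // j _; apply.
have mass X : \sum_i X i = 1 -> \sum_i (X i - d * nu i) = 1 - d.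
  by move=> X1; rewrite sumrB -mulr_sumr X1 nu1 mulr1.
have split X : \sum_i X i * g i =
    \sum_i (X i - d * nu i) * g i + \sum_i d * nu i * g i.
  by rewrite -big_split/=; apply: eq_bigr => i _; ring.
rewrite (split P) (split Q).
have hP : \sum_i (P i - d * nu i) * g i <= (1 - d) * (g k + D).
  rewrite -(mass P P1) mulr_suml; apply: ler_sum => i _.
  by rewrite ler_wpM2l ?subr_ge0// addrC -lerBlDr.
have hQ : (1 - d) * g k <= \sum_i (Q i - d * nu i) * g i.
  rewrite -(mass Q Q1) mulr_suml; apply: ler_sum => i _.
  by rewrite ler_wpM2l ?subr_ge0.
by lra.
Qed.

(* Stated on the support of [p]: with [ln 0 = 0], a word of measure zero would
   otherwise contribute [expR (s i)]. *)
Lemma gibbs_inequality (p s : I -> R) :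
  (forall i, 0 <= p i) -> \sum_i p i = 1 ->
  \sum_i p i * s i + \sum_i - (p i * ln (p i)) <=
    ln (\sum_(i | 0 < p i) expR (s i)).
Proof.
move=> p0 p1; set Z := \sum_(i | 0 < p i) expR (s i).
have Z0 : 0 < Z.
  have [i pi|pz] := pickP (fun i => 0 < p i).
    rewrite /Z (bigD1 i)//= ltr_wpDr ?expR_gt0//.
        by apply: sumr_ge0 => j _; exact: expR_ge0.
  move: p1; rewrite big1 => [/eqP|i _]; first by rewrite eq_sym oner_eq0.
  by apply/eqP; rewrite eq_le p0 leNgt pz.
rewrite -subr_le0 -[X in _ - X]mul1r -p1 mulr_suml -big_split/= -sumrB.
rewrite [leRHS](_ : 0 = \sum_(i | 0 < p i) expR (s i) / Z - \sum_i p i); last first.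
  by rewrite -mulr_suml p1 divff ?subrr// gt_eqF.
rewrite (big_mkcond (fun i => 0 < p i))/= -sumrB.
apply: ler_sum => i _; case: ltP => [pi|pi]; last first.
  have -> : p i = 0 by apply/eqP; rewrite eq_le p0 pi.
  by rewrite !(mul0r, subr0).
(* Termwise the claim is ln y <= y - 1 at this y, weighted by [p i]. *)
have y0 : 0 < expR (s i) / (p i * Z) by rewrite divr_gt0 ?expR_gt0 ?mulr_gt0.
have : ln (expR (s i) / (p i * Z)) <= expR (s i) / (p i * Z) - 1.
  by rewrite -[X in ln X](subrK 1) addrC le_ln1Dx// ltrBrDl subrr.
rewrite ln_div ?posrE ?expR_gt0 ?mulr_gt0// expRK lnM ?posrE//.
move=> /(ler_wpM2l (ltW pi)); rewrite [_ * (_ - 1)]mulrBr mulr1.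
rewrite (_ : p i * (expR _ / (p i * Z)) = expR (s i) / Z); last first.
  by field; rewrite !gt_eqF.
by apply: le_trans; rewrite le_eqVlt; apply/orP; left; apply/eqP; ring.
Qed.

End FiniteAverages.

(** * Sums over words *)

Lemma big_tuple0 (V : nmodType) (S : finType) (F : seq S -> V) :
  \sum_(w : 0.-tuple S) F w = F [::].
Proof.
rewrite (bigD1 [tuple])//= big1 ?addr0// => w.
by rewrite tuple0.
Qed.

Lemma big_tupleS (V : nmodType) (S : finType) n (F : seq S -> V) :
  \sum_(w : n.+1.-tuple S) F w = \sum_a \sum_(v : n.-tuple S) F (a :: v).
Proof.
rewrite pair_big/=.
rewrite (reindex (fun p : S * n.-tuple S => [tuple of p.1 :: p.2]))//=.
exists (fun w => (thead w, [tuple of behead w])) => [[a v] _|w _] /=.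
  by congr pair; apply: val_inj.
by rewrite -tuple_eta.
Qed.

Lemma big_tupleD (V : nmodType) (S : finType) m n (F : seq S -> V) :
  \sum_(w : (m + n).-tuple S) F w =
    \sum_(u : m.-tuple S) \sum_(v : n.-tuple S) F (u ++ v).
Proof.
elim: m F => [|m IH] F.
  by rewrite (big_tuple0 (fun u : seq S => \sum_(v : n.-tuple S) F (u ++ v))).
rewrite [RHS](big_tupleS _ (fun u => \sum_(v : n.-tuple S) F (u ++ v))) big_tupleS.
by apply: eq_bigr => a _; rewrite (IH (fun w => F (a :: w))).
Qed.

(** * Uniformly distributed paths *)

Section HammingLipschitz.
Context {R : realType} {S : finType}.
Implicit Types (F : seq S -> R) (u v : seq S).

Definition hamming_lipschitz F :=
  forall u a b v, `|F (u ++ a :: v) - F (u ++ b :: v)| <= 1.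

Lemma hamming_lipschitz_cat u F :
  hamming_lipschitz F -> hamming_lipschitz (fun v => F (u ++ v)).
Proof. by move=> FL u' a b v; rewrite !catA; exact: FL. Qed.

Lemma hamming_lipschitz_prefix F u u' v : hamming_lipschitz F ->
  size u = size u' -> `|F (u ++ v) - F (u' ++ v)| <= (size u)%:R.
Proof.
elim: u u' F => [|a u IH] [|b u']//= F FL; first by rewrite subrr normr0.
move=> [uu']; rewrite -natr1.
have h1 := FL [::] a b (u' ++ v).
have h2 := IH u' _ (hamming_lipschitz_cat [:: a] FL) uu'.
apply: le_trans (lerD h2 h1).
by apply: le_trans (ler_normD _ _); rewrite /= addrA subrK.
Qed.

End HammingLipschitz.

Section PathMeans.
Context {R : realType} {S : finType} (A : rel S).
Implicit Types (F G : seq S -> R) (a b c : S).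

(** The starting state [a] is not a letter of [v], so [L] counts steps. [path_mean] is the
    expectation under the uniform law on admissible paths of [L] steps from [a]. *)
Definition path_sum L a F : R := \sum_(v : L.-tuple S | path A a v) F v.
Definition path_count L a : R := path_sum L a (fun=> 1).
Definition path_mean L a F : R := path_sum L a F / path_count L a.
(** The entry at [(a, c)] of the [r]-th power of the transition matrix. *)
Definition path_count_to r a c : R := path_sum r a (fun u => (last a u == c)%:R).

Lemma path_sum0 a F : path_sum 0 a F = F [::].
Proof.
rewrite /path_sum big_mkcond.
exact: (big_tuple0 (fun v => if path A a v then F v else 0)).
Qed.

Lemma path_sumS L a F :
  path_sum L.+1 a F = \sum_(b | A a b) path_sum L b (fun v => F (b :: v)).
Proof.
rewrite /path_sum big_mkcond/= [RHS]big_mkcond.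
rewrite (big_tupleS _ (fun v => if path A a v then F v else 0)) /=.
apply: eq_bigr => b _; case: (A a b) => /=; last by rewrite big1.
by rewrite -big_mkcond.
Qed.

Lemma path_sumD r L a F : path_sum (r + L) a F =
  path_sum r a (fun u => path_sum L (last a u) (fun v => F (u ++ v))).
Proof.
rewrite /path_sum big_mkcond/= [RHS]big_mkcond.
rewrite (big_tupleD _ _ (fun v => if path A a v then F v else 0)) /=.
apply: eq_bigr => u _; under eq_bigr do rewrite cat_path.
by case: (path A a u) => /=; [rewrite -big_mkcond | rewrite big1].
Qed.

Lemma path_sum_last r a (h : S -> R) :
  path_sum r a (fun u => h (last a u)) = \sum_c path_count_to r a c * h c.
Proof.
rewrite /path_count_to /path_sum.
under [RHS]eq_bigr do rewrite mulr_suml.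
rewrite exchange_big/=; apply: eq_bigr => u _.
rewrite (bigD1 (last a u))//= eqxx mul1r big1 ?addr0// => c.
by rewrite eq_sym => /negbTE ->; rewrite mul0r.
Qed.

(** The continuation of a path depends on its first [r] steps only through their endpoint, so these
    steps enter only by a count. *)
Lemma path_sum_endpoint r L a F : path_sum (r + L) a (fun w => F (drop r w)) =
  \sum_c path_count_to r a c * path_sum L c F.
Proof.
rewrite path_sumD -(path_sum_last _ _ (fun c => path_sum L c F)).
apply: eq_bigr => u _; apply: eq_bigr => v _.
by rewrite drop_size_cat// size_tuple.
Qed.

Hypothesis A_succ : forall a, exists b, A a b.

Lemma path_count_gt0 L a : 0 < path_count L a.
Proof.
elim: L a => [|L IH] a; first by rewrite /path_count path_sum0.
have [b ab] := A_succ a.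
rewrite /path_count path_sumS (bigD1 b)//= ltr_wpDr ?IH//.
by apply: sumr_ge0 => c _; exact/ltW/IH.
Qed.

Lemma ler_path_mean L a F G :
  (forall v, size v = L -> F v <= G v) -> path_mean L a F <= path_mean L a G.
Proof.
move=> FG; rewrite ler_pM2r ?invr_gt0 ?path_count_gt0//.
by apply: ler_sum => v _; apply: FG; rewrite size_tuple.
Qed.

Lemma path_meanD L a F G :
  path_mean L a (fun v => F v + G v) = path_mean L a F + path_mean L a G.
Proof. by rewrite /path_mean /path_sum big_split/= mulrDl. Qed.

Lemma path_mean_cst L a (k : R) : path_mean L a (fun=> k) = k.
Proof.
have -> : path_mean L a (fun=> k) = k * path_count L a / path_count L a.
  by congr (_ / _); rewrite /path_count /path_sum mulr_sumr mulr1.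
by rewrite mulfK// gt_eqF ?path_count_gt0.
Qed.

Lemma path_mean_near L a F G (d : R) :
  (forall v, size v = L -> `|F v - G v| <= d) ->
  `|path_mean L a F - path_mean L a G| <= d.
Proof.
move=> FG; rewrite ler_distl -(path_mean_cst L a (- d)) -{2}(path_mean_cst L a d).
rewrite -!path_meanD; apply/andP; split; apply: ler_path_mean => v /FG;
  by rewrite ler_distl => /andP[].
Qed.

(** Conditioning on the first letter: under the uniform law a step to [b] is weighted by the number
    of its continuations, so the step law depends on the remaining length. *)
Lemma path_meanS L a F : path_mean L.+1 a F =
  \sum_b (A a b)%:R * path_count L b / path_count L.+1 a *
    path_mean L b (fun v => F (b :: v)).
Proof.
rewrite /path_mean path_sumS mulr_suml big_mkcond; apply: eq_bigr => b _.
case: (A a b); last by rewrite !mul0r.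
rewrite mul1r; field.
by rewrite !gt_eqF ?path_count_gt0.
Qed.

Lemma path_step_weight L a :
  \sum_b (A a b)%:R * path_count L b / path_count L.+1 a = 1.
Proof.
rewrite -[RHS](path_mean_cst L.+1 a 1) path_meanS.
by apply: eq_bigr => b _; rewrite path_mean_cst mulr1.
Qed.

Variables (r : nat).
Hypothesis A_mix : forall a c, exists2 u : r.-tuple S, path A a u & last a u = c.

Let K : R := #|{: r.-tuple S}|.+1%:R.
(** Solves D = 2r + (1 - 1/K) D: one round of the Doeblin comparison costs [r] for each of the two
    starting states and contracts the rest by 1 - 1/K. *)
Let D : R := 2 * r%:R * K.

Lemma path_count_to_ge1 a c : 1 <= path_count_to r a c.
Proof.
have [u pu lu] := A_mix a c; rewrite /path_count_to /path_sum (bigD1 u)//= lu eqxx.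
by rewrite lerDl; apply: sumr_ge0.
Qed.

Lemma path_count_to_le a c : path_count_to r a c <= K.
Proof.
rewrite /K -natr1 -sumr_const ler_wpDr// /path_count_to /path_sum big_mkcond.
by apply: ler_sum => u _; case: ifP => // _; case: eqP.
Qed.

(* Endpoint distributions after [r] steps all dominate a common multiple of
   [path_count L], whatever the starting point: Doeblin's condition for
   uniformly distributed paths. *)
Lemma path_mean_osc L a b F : hamming_lipschitz F ->
  path_mean L a F - path_mean L b F <= D.
Proof.
have K1 : 1 <= K by rewrite /K ler1n.
have r0 : 0 <= r%:R :> R by [].
elim/ltn_ind: L a b F => L IH a b F FL.
(* Short paths: both means are within [r] of the value of [F] at one fixed word, and 2r <= D because
   [K] is at least 1. *)
have [Lr|rL] := ltnP L r.
  have near c : `|path_mean L c F - path_mean L c (fun=> F (nseq L a))| <= r%:R.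
    apply: path_mean_near => v sv; rewrite -[v]cats0 -[nseq L a]cats0.
    apply: le_trans (hamming_lipschitz_prefix _ FL _) _; rewrite ?size_nseq ?sv//.
    by rewrite ler_nat ltnW.
  move: (near a) (near b); rewrite !path_mean_cst !ler_distl => /andP[_ ha] /andP[hb _].
  by rewrite /D; nra.
(* For [r] zero, [A_mix] forces [a] and [b] to coincide; otherwise removing [r] steps really
   shortens the path, as the induction requires. *)
have [r_0|r_gt0] := posnP r.
  have [u _] := A_mix a b; move: u; rewrite r_0 => u; rewrite (tuple0 u)/= => ->.
  by rewrite subrr /D r_0 mulr0 mul0r.
have [L' Ldecomp] : exists L', L = (r + L')%N by exists (L - r)%N; rewrite subnKC.
have L'L : (L' < L)%N by rewrite Ldecomp -addn1 addnC leq_add2r.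
(* Freezing the first [r] letters changes [F] by at most [r] and leaves a function of the tail
   alone, whose mean depends on the start only through the law of the endpoint. *)
pose G v := F (nseq r a ++ v).
have GL : hamming_lipschitz G by exact: hamming_lipschitz_cat.
pose T := \sum_c path_count L' c.
(* The probability that a uniform path of [L] steps from [c] is at [e] after [r] steps. *)
pose P c e := path_count_to r c e * path_count L' e / path_count L c.
have T0 : 0 < T.
  rewrite /T (bigD1 a)//= ltr_wpDr ?path_count_gt0//.
  by apply: sumr_ge0 => c _; exact/ltW/path_count_gt0.
have countE c : path_count L c = \sum_e path_count_to r c e * path_count L' e.
  by rewrite Ldecomp /path_count -path_sum_endpoint.
have near c : `|path_mean L c F - \sum_e P c e * path_mean L' e G| <= r%:R.
  rewrite (_ : \sum_e _ = path_mean L c (fun w => G (drop r w))); last first.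
    rewrite /path_mean [in path_sum _ _ _]Ldecomp path_sum_endpoint mulr_suml.
    apply: eq_bigr => e _; rewrite /P; field.
    by rewrite !gt_eqF ?path_count_gt0.
  apply: path_mean_near => v sv; rewrite -{1}[v](cat_take_drop r) /G.
  have st : size (take r v) = r by rewrite size_takel// sv.
  by apply: le_trans (hamming_lipschitz_prefix _ FL _) _; rewrite st ?size_nseq.
(* The numerator holds at least one path from [c] to [e], by mixing, and the denominator is at most
   [K * T] because there are at most [K] such paths to each state. *)
have Pnu c e : K^-1 * (path_count L' e / T) <= P c e.
  have countKT : path_count L c <= K * T.
    rewrite countE mulr_sumr; apply: ler_sum => e' _.
    by rewrite ler_wpM2r ?(ltW (path_count_gt0 _ _))// path_count_to_le.
  rewrite /P ler_pdivlMr ?path_count_gt0//.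
  apply: (@le_trans _ _ (K^-1 * (path_count L' e / T) * (K * T))).
    by rewrite ler_wpM2l// !mulr_ge0 ?invr_ge0 ?(ltW (path_count_gt0 _ _))
      ?(ltW T0) ?(le_trans _ K1).
  rewrite (_ : _ * (K * T) = 1 * path_count L' e); last first.
    by field; rewrite !gt_eqF// (lt_le_trans _ K1).
  by rewrite ler_wpM2r ?(ltW (path_count_gt0 _ _))// path_count_to_ge1.
have P1 c : \sum_e P c e = 1.
  by rewrite /P -mulr_suml -countE divff// gt_eqF ?path_count_gt0.
have nu1 : \sum_e path_count L' e / T = 1.
  by rewrite -mulr_suml divff// gt_eqF.
have K'0 : 0 <= K^-1 by rewrite invr_ge0 (le_trans _ K1).
have := doeblin_contraction K'0 (Pnu a) (Pnu b) (P1 a) (P1 b) nu1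
  (fun c e => IH L' L'L c e G GL).
move: (near a) (near b); rewrite !ler_distl => /andP[_ ha] /andP[hb _].
have -> : (1 - K^-1) * D = D - 2 * r%:R.
  by rewrite /D; field; rewrite gt_eqF// (lt_le_trans _ K1).
lra.
Qed.

(** Induction on the first letter. The conditional means given that letter differ by at most
    [D + 1]: [D] for the new starting state and 1 for the changed letter. Each step thus contributes
    one factor from [exp_moment_le]. *)
Lemma path_exp_moment L a F t : hamming_lipschitz F ->
  path_mean L a (fun v => expR (t * F v)) <=
    expR (t * path_mean L a F + 2 * t ^+ 2 * (D + 1) ^+ 2 * L%:R).
Proof.
elim: L a F => [|L IH] a F FL.
  rewrite /path_mean /path_count !path_sum0 mulr0 addr0.
  by rewrite !divr1.
pose q b := (A a b)%:R * path_count L b / path_count L.+1 a.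
pose g b := path_mean L b (fun v => F (b :: v)).
have q0 b : 0 <= q b.
  by rewrite !mulr_ge0 ?invr_ge0 ?(ltW (path_count_gt0 _ _)).
have FcL b : hamming_lipschitz (fun v => F (b :: v)).
  exact: (@hamming_lipschitz_cat _ _ [:: b]).
have gD b c : `|g b - g c| <= D + 1.
  have half b' c' : g b' - g c' <= D + 1.
    have h1 := path_mean_osc L b' c' (FcL b').
    have : `|path_mean L c' (fun v => F (b' :: v)) - g c'| <= 1.
      by apply: path_mean_near => v _; exact: (FL [::]).
    by rewrite ler_distl => /andP[_ h2]; rewrite /g in h2 *; lra.
  by rewrite ler_norml half andbT lerNl opprB half.
rewrite !path_meanS -/(q _).
apply: (@le_trans _ _ (\sum_b q b * (expR (t * g b) *
    expR (2 * t ^+ 2 * (D + 1) ^+ 2 * L%:R)))).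
  apply: ler_sum => b _; apply: ler_wpM2l; rewrite ?q0// -expRD.
  exact: (IH b _ (FcL b)).
under eq_bigr do rewrite mulrA.
rewrite -mulr_suml -(natr1 L) [_ * (L%:R + 1)]mulrDr mulr1 addrA addrAC.
rewrite [expR (_ + _)]expRD.
by rewrite ler_wpM2r ?expR_ge0// exp_moment_le// path_step_weight.
Qed.

(** A word of [N.+1] letters is a first letter followed by a path of [N] steps. Replacing each first
    letter by the reference [s0] moves the mean by at most [D + 1], whence the term in the absolute
    value of [t]. *)
Lemma word_exp_moment N s0 F t : hamming_lipschitz F ->
  \sum_(w : N.+1.-tuple S | sorted A w) expR (t * F w) <=
  #|[set w : N.+1.-tuple S | sorted A w]%SET|%:R *
    expR (t * path_mean N s0 (fun v => F (s0 :: v)) +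
          2 * t ^+ 2 * (D + 1) ^+ 2 * N%:R + `|t| * (D + 1)).
Proof.
move=> FL; rewrite -sum1_card natr_sum mulr_suml.
under [leRHS]eq_bigl do rewrite inE.
rewrite big_mkcond [leRHS]big_mkcond.
rewrite (big_tupleS _ (fun w => if sorted A w then expR (t * F w) else 0)).
rewrite (big_tupleS _ (fun w => if sorted A w then 1%:R * _ else 0)).
apply: ler_sum => a _; rewrite /= -!big_mkcond/= -mulr_suml.
rewrite -/(path_sum _ _ (fun v => expR (t * F (a :: v)))).
rewrite -/(path_sum _ _ (fun=> 1)) -/(path_count _ _).
rewrite mulrC -ler_pdivrMr ?path_count_gt0//.
have FcL b : hamming_lipschitz (fun v => F (b :: v)).
  exact: (@hamming_lipschitz_cat _ _ [:: b]).
apply: le_trans (path_exp_moment N a t (FcL a)) _.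
rewrite ler_expR addrAC lerD2r -lerBlDl -mulrBr.
apply: le_trans (ler_norm _) _; rewrite normrM ler_wpM2l//.
have half b' c' : path_mean N b' (fun v => F (b' :: v)) -
    path_mean N c' (fun v => F (c' :: v)) <= D + 1.
  have h1 := path_mean_osc N b' c' (FcL b').
  have : `|path_mean N c' (fun v => F (b' :: v)) -
           path_mean N c' (fun v => F (c' :: v))| <= 1.
    by apply: path_mean_near => v _; exact: (FL [::]).
  by rewrite ler_distl => /andP[_ h2]; lra.
by rewrite ler_norml half andbT lerNl opprB half.
Qed.

End PathMeans.

(** * Words, Birkhoff sums and pressure *)

(** Adding the linear term [C * n] keeps subadditivity and makes the sequence nonnegative, so the
    infimum of the ratios exists; the limit is this infimum minus [C]. *)
Lemma fekete_cvg {R : realType} (u : R^nat) (C : R) :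
  (forall m n, u (m + n)%N <= u m + u n) -> (forall n, - (C * n%:R) <= u n) ->
  cvgn (fun n => n%:R^-1 * u n).
Proof.
move=> u_sub u_ge.
pose v n := u n + C * n%:R.
have v0 n : 0 <= v n by rewrite /v -lerBlDr sub0r.
have v_sub m n : v (m + n)%N <= v m + v n.
  by have := u_sub m n; rewrite /v natrD; lra.
have v_mulD k q r : v (q * k + r)%N <= q%:R * v k + v r.
  elim: q => [|q IH]; first by rewrite !mul0n mul0r add0r.
  rewrite mulSn -addnA; apply: le_trans (v_sub _ _) _.
  by rewrite -natr1; move: IH; nra.
pose E := [set x | exists2 n, (0 < n)%N & x = v n / n%:R].
have E_inf : has_inf E.
  split; first by exists (v 1 / 1); exists 1%N.
  by exists 0 => _ [n _ ->]; rewrite divr_ge0.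
apply/cvg_ex; exists (inf E - C); apply/cvgrPdist_le => e e0.
have e2 : 0 < e / 2 by rewrite divr_gt0.
have [_ [k k0 ->] vk] := inf_adherent e2 E_inf.
(* Bounds the remainder left by Euclidean division of [n] by [k], uniformly in [n]. *)
pose B := \sum_(r < k) v r.
have vB (r : nat) : (r < k)%N -> v r <= B.
  move=> rk; rewrite /B (bigD1 (Ordinal rk))//= lerDl.
  by apply: sumr_ge0.
near=> n.
have n0 : (0 < n)%N by near: n; exact: nbhs_infty_gt.
have n0R : 0 < n%:R :> R by rewrite ltr0n.
have k0R : 0 < k%:R :> R by rewrite ltr0n.
have Bn : B / n%:R <= e / 2.
  rewrite ler_pdivrMr// mulrC -ler_pdivrMr//.
  by near: n; exact: nbhs_infty_ger.
have uv : n%:R^-1 * u n = v n / n%:R - C.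
  by rewrite /v; field; rewrite gt_eqF.
have lo : inf E <= v n / n%:R by apply: ge_inf; [case: E_inf|exists n].
have hi : v n / n%:R <= v k / k%:R + B / n%:R.
  rewrite ler_pdivrMr// mulrDl divfK ?gt_eqF//.
  rewrite {1}(divn_eq n k); apply: le_trans (v_mulD _ _ _) _.
  rewrite lerD ?vB ?ltn_mod//.
  have -> : (n %/ k)%:R * v k = v k / k%:R * (n %/ k * k)%:R.
    by rewrite natrM; field; rewrite gt_eqF.
  by rewrite ler_wpM2l ?divr_ge0// ler_nat leq_trunc_div.
rewrite uv distrC ger0_norm; last by lra.
lra.
Unshelve. all: by end_near. Qed.

Section Words.
Context {S : finType} (s0 : S) (A : rel S).
Implicit Types (w u v : seq S) (x y : nat -> S).

(** Here words are plain sequences, so that they can be concatenated freely. *)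
Definition seq_cylinder w : set (nat -> S) :=
  [set x | sft A x /\ forall i, (i < size w)%N -> x i = nth s0 w i].

Lemma cylinderE n (w : n.-tuple S) : cylinder A w = seq_cylinder w.
Proof.
apply/seteqP; split=> x [xA xw]; split=> // i.
  by rewrite size_tuple => i_n; rewrite (xw (Ordinal i_n)) (tnth_nth s0).
by rewrite (tnth_nth s0) xw// size_tuple.
Qed.

Lemma iter_shift j x i : iter j (@Defs.shift S) x i = x (j + i)%N.
Proof. by elim: j i => //= j IH i; rewrite /Defs.shift IH addnS. Qed.

Lemma sft_iter_shift j x : sft A x -> sft A (iter j (@Defs.shift S) x).
Proof. by move=> xA n; rewrite !iter_shift addnS; exact: xA. Qed.

Lemma seq_cylinder_cat u v :
  seq_cylinder (u ++ v) =
    seq_cylinder u `&` iter (size u) (@Defs.shift S) @^-1` seq_cylinder v.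
Proof.
apply/seteqP; split=> x.
  move=> [xA xuv]; split; split=> //.
  - by move=> i iu; rewrite xuv ?nth_cat ?iu// size_cat ltn_addr.
  - exact: sft_iter_shift.
  - move=> i iv; rewrite iter_shift xuv ?size_cat ?ltn_add2l//.
    by rewrite nth_cat ltnNge leq_addr/= addKn.
move=> [[xA xu] [_ xv]]; split=> // i; rewrite size_cat nth_cat => iuv.
case: ltnP => [|ui]; first exact: xu.
by rewrite -xv ?iter_shift ?subnKC// ltn_subLR.
Qed.

Hypothesis A_succ : forall a, exists b, A a b.

(** Without dead ends, a fixed choice of successor for each letter continues the word forever. *)
Lemma path_extends a v : path A a v ->
  exists x, [/\ sft A x, x 0%N = a & forall i, (i < size v)%N -> x i.+1 = nth s0 v i].
Proof.
elim: v a => [|b v IH] a /=.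
  pose f c := sval (cid (A_succ c)); have fA c : A c (f c) := svalP (cid (A_succ c)).
  by move=> _; exists (fun n => iter n f a); split=> // n /=.
move=> /andP[ab /IH[x [xA x0 xv]]].
exists (fun n => if n is n'.+1 then x n' else a); split=> //.
  by case=> [|n] /=; [rewrite x0|exact: xA].
by case=> [|i] //= iv; exact: xv.
Qed.

Lemma seq_cylinder_neq0 w : seq_cylinder w !=set0 <-> sorted A w.
Proof.
split=> [[x [xA xw]]|].
  apply/(sortedP s0) => i iw; rewrite -!xw//; exact: (leq_trans _ iw).
case: w => [|a v] /=.
  by have [x [xA _ _]] := @path_extends s0 [::] isT; exists x; split.
move=> /path_extends[x [xA x0 xv]]; exists x; split=> // -[|i] //=.
exact: xv.
Qed.

Lemma in_language n (w : n.-tuple S) : (w \in language A n) = sorted A w.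
Proof.
rewrite inE cylinderE; apply/asboolP/idP; last by move/seq_cylinder_neq0.
by move/seq_cylinder_neq0.
Qed.

Lemma sft_neq0 : sft A !=set0.
Proof. by have [x [xA _ _]] := @path_extends s0 [::] isT; exists x. Qed.

End Words.

(** * Partition sums and existence of the pressure *)

Section Pressure.
Context {R : realType} {S : finType} (s0 : S) (A : rel S).
Hypothesis A_succ : forall a, exists b, A a b.
Implicit Types (psi phi : (nat -> S) -> R) (x y : nat -> S).

Definition partition_sum psi n : R :=
  \sum_(w in language A n) expR (sup (birkhoff_sum psi n @` cylinder A w)).

Lemma birkhoff_sumD psi m n x : birkhoff_sum psi (m + n) x =
  birkhoff_sum psi m x + birkhoff_sum psi n (iter m (@Defs.shift S) x).
Proof.
rewrite /birkhoff_sum (big_cat_nat _ (leq_addr n m))//=; congr (_ + _).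
rewrite -{1}[m]add0n big_addn addKn; apply: eq_bigr => j _.
by rewrite iterD.
Qed.

Section Bounded.
Variables (psi : (nat -> S) -> R) (C : R).
Hypothesis psiC : forall x, sft A x -> `|psi x| <= C.

Lemma birkhoff_sum_bound n x : sft A x -> `|birkhoff_sum psi n x| <= C * n%:R.
Proof.
move=> xA; rewrite /birkhoff_sum; apply: le_trans (ler_norm_sum _ _ _) _.
rewrite mulr_natr -[X in _ *+ X]subn0 -sumr_const_nat; apply: ler_sum => j _.
by apply: psiC; exact: sft_iter_shift.
Qed.

Let word_sup n w := sup (birkhoff_sum psi n @` seq_cylinder s0 A w).

Lemma birkhoff_le_word_sup n w x : seq_cylinder s0 A w x ->
  birkhoff_sum psi n x <= word_sup n w.
Proof.
move=> xw; apply: ub_le_sup; last by exists x.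
exists (C * n%:R) => _ [y [yA _] <-].
by apply: le_trans (ler_norm _) _; exact: birkhoff_sum_bound.
Qed.

Let weight n w := if sorted A w then expR (word_sup n w) else 0.

Lemma partition_sumE n : partition_sum psi n = \sum_(w : n.-tuple S) weight n w.
Proof.
rewrite /partition_sum big_mkcond; apply: eq_bigr => w _.
by rewrite (in_language s0)// /weight /word_sup (cylinderE s0).
Qed.

Lemma weight_ge0 n w : 0 <= weight n w.
Proof. by rewrite /weight; case: ifP => // _; exact: expR_ge0. Qed.

(** A point of the cylinder of [u ++ v] lies in that of [u], its shift lies in that of [v], and the
    Birkhoff sum splits accordingly. Hence the logarithms of the partition sums are subadditive. *)
Lemma weight_cat n u v :
  weight (size u + n) (u ++ v) <= weight (size u) u * weight n v.
Proof.
rewrite {1}/weight; case: ifP => [suv|_]; last by rewrite mulr_ge0 ?weight_ge0.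
have cu x : seq_cylinder s0 A (u ++ v) x -> seq_cylinder s0 A u x.
  by rewrite seq_cylinder_cat => -[].
have cv x : seq_cylinder s0 A (u ++ v) x ->
    seq_cylinder s0 A v (iter (size u) (@Defs.shift S) x).
  by rewrite seq_cylinder_cat => -[].
have /(seq_cylinder_neq0 s0 A_succ)[x xuv] := suv.
have su : sorted A u by apply/(seq_cylinder_neq0 s0 A_succ); exists x; exact: cu.
have sv : sorted A v.
  by apply/(seq_cylinder_neq0 s0 A_succ); eexists; exact: (cv _ xuv).
rewrite /weight su sv -expRD ler_expR; apply: ge_sup.
  by exists (birkhoff_sum psi (size u + n) x), x.
move=> _ [y yuv <-]; rewrite birkhoff_sumD lerD//.
  exact/birkhoff_le_word_sup/cu.
exact/birkhoff_le_word_sup/cv.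
Qed.

(** The initial word of any one point of the shift already has this weight. This makes the logarithm
    meaningful and gives the linear lower bound for [fekete_cvg]. *)
Lemma partition_sum_ge n : expR (- (C * n%:R)) <= partition_sum psi n.
Proof.
have [x xA] := sft_neq0 s0 A_succ.
have xw : cylinder A [tuple x (val i) | i < n] x.
  by split=> // i; rewrite tnth_mktuple.
rewrite /partition_sum (bigD1 [tuple x (val i) | i < n]); last first.
  by rewrite inE; apply/asboolP; exists x.
rewrite /= ler_wpDr//; first by apply: sumr_ge0 => w _; exact: expR_ge0.
rewrite ler_expR; rewrite (cylinderE s0) in xw *.
apply: le_trans (birkhoff_le_word_sup n xw).
by rewrite lerNl; apply: le_trans (birkhoff_sum_bound n xA); rewrite -normrN ler_norm.
Qed.

Lemma partition_sum_gt0 n : 0 < partition_sum psi n.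
Proof. exact: lt_le_trans (expR_gt0 _) (partition_sum_ge n). Qed.

Lemma pressure_cvg : cvgn (fun n : nat => n%:R^-1 * ln (partition_sum psi n)).
Proof.
apply: (@fekete_cvg _ (fun n => ln (partition_sum psi n)) C) => [m n|n].
  rewrite -lnM ?posrE ?partition_sum_gt0// ler_ln ?posrE ?mulr_gt0 ?partition_sum_gt0//.
  rewrite !partition_sumE (big_tupleD _ _ (weight (m + n))) mulr_suml.
  apply: ler_sum => u _; rewrite mulr_sumr; apply: ler_sum => v _.
  by have := weight_cat n u v; rewrite size_tuple.
by rewrite -[leLHS]expRK ler_ln ?posrE ?expR_gt0 ?partition_sum_gt0// partition_sum_ge.
Qed.

End Bounded.

(** The zero potential turns the pressure sequence into the one defining [htop], whose convergence
    then follows from [pressure_cvg]. *)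
Lemma partition_sum_zero phi n :
  partition_sum (fun x => 0 * phi x) n = #|language A n|%:R.
Proof.
rewrite /partition_sum -sum1_card natr_sum; apply: eq_bigr => w.
rewrite inE => /asboolP[x xw].
rewrite (_ : _ @` _ = [set 0]) ?sup1 ?expR0//.
have zero y : birkhoff_sum (fun x => 0 * phi x) n y = 0.
  by rewrite /birkhoff_sum big1// => j _; rewrite mul0r.
apply/seteqP; split=> [_ [y _ <-] /=|_ ->]; rewrite ?zero//.
by exists x => //; rewrite zero.
Qed.

End Pressure.

(** * Lipschitz extension off the shift *)

Section McShane.
Context {R : realType} {S : finType} (A : rel S) (n : nat).
Implicit Types (phi : (nat -> S) -> R) (x y : nat -> S).

Lemma hamming_distE x y :
  hamming_dist R n x y = n%:R^-1 * \sum_(i < n) (x i != y i)%:R.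
Proof.
congr (_ * _); rewrite -sum1_card natr_sum big_mkcond; apply: eq_bigr => i _.
by rewrite inE; case: (x i != y i).
Qed.

Lemma hamming_dist_ge0 x y : 0 <= hamming_dist R n x y.
Proof. by rewrite mulr_ge0 ?invr_ge0. Qed.

Lemma hamming_dist_le1 x y : hamming_dist R n x y <= 1.
Proof.
have [->|n0] := posnP n; first by rewrite /hamming_dist invr0 mul0r.
rewrite /hamming_dist ler_pdivrMl ?ltr0n// mulr1 ler_nat.
by rewrite -[leqRHS]card_ord max_card.
Qed.

Lemma hamming_dist_sym x y : hamming_dist R n x y = hamming_dist R n y x.
Proof. by rewrite !hamming_distE; under eq_bigr do rewrite eq_sym. Qed.

Lemma hamming_dist_triangle x y z :
  hamming_dist R n x z <= hamming_dist R n x y + hamming_dist R n y z.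
Proof.
rewrite !hamming_distE -mulrDr ler_wpM2l ?invr_ge0// -big_split/=.
apply: ler_sum => i _; rewrite -natrD ler_nat.
by case: eqP => // xz; case: eqP => // xy; case: eqP => // yz; case: xz; rewrite xy.
Qed.

(** Changing a single letter of a word can leave the shift, where [phi] is unconstrained. This
    extension agrees with [phi] on the shift and is Lipschitz on all sequences. *)
Definition mcshane phi x : R := inf [set phi y + hamming_dist R n x y | y in sft A].

Variable phi : (nat -> S) -> R.
Hypothesis phiL : Omega_n A n phi.
Hypothesis A0 : sft A !=set0.

Let has_inf_mcshane x : has_inf [set phi y + hamming_dist R n x y | y in sft A].
Proof.
have [z zA] := A0; split; first by exists (phi z + hamming_dist R n x z), z.
exists (phi z - 1) => _ [y yA <-].
have := phiL zA yA; rewrite ler_distl => /andP[_ h].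
by have := hamming_dist_le1 z y; have := hamming_dist_ge0 x y; lra.
Qed.

Lemma mcshane_id x : sft A x -> mcshane phi x = phi x.
Proof.
move=> xA; apply/eqP; rewrite eq_le; apply/andP; split.
  rewrite (le_trans (ge_inf (has_inf_mcshane x).2 (ex_intro2 _ _ x xA erefl)))//.
  by rewrite hamming_distE big1 ?mulr0 ?addr0// => i _; rewrite eqxx.
apply: lb_le_inf (has_inf_mcshane x).1 _ => _ [y yA <-].
by have := phiL xA yA; rewrite ler_distl => /andP[].
Qed.

Lemma mcshane_lipschitz x y :
  `|mcshane phi x - mcshane phi y| <= hamming_dist R n x y.
Proof.
have half x' y' : mcshane phi x' - mcshane phi y' <= hamming_dist R n x' y'.
  rewrite lerBlDl -lerBlDr; apply: lb_le_inf (has_inf_mcshane y').1 _ => _ [z zA <-].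
  have : mcshane phi x' <= phi z + hamming_dist R n x' z.
    by apply: (ge_inf (has_inf_mcshane x').2); exists z.
  by have := hamming_dist_triangle x' y' z; lra.
by rewrite ler_norml half andbT lerNl opprB hamming_dist_sym half.
Qed.

Hypothesis n_gt0 : (0 < n)%N.

(** A coordinate lies in at most [n] of the shifted windows, each weighing it by 1/n, so it counts
    at most once whatever [n] is. *)
Lemma birkhoff_sum_lipschitz N x y :
  `|birkhoff_sum (mcshane phi) N x - birkhoff_sum (mcshane phi) N y| <=
    \sum_(0 <= k < n + N) (x k != y k)%:R.
Proof.
rewrite /birkhoff_sum -sumrB; apply: le_trans (ler_norm_sum _ _ _) _.
apply: (@le_trans _ _ (\sum_(0 <= j < N) n%:R^-1 *
    \sum_(i < n) (x (j + i)%N != y (j + i)%N)%:R)).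
  apply: ler_sum => j _; apply: le_trans (mcshane_lipschitz _ _) _.
  by rewrite hamming_distE; under eq_bigr do rewrite !iter_shift.
rewrite -mulr_sumr exchange_big/= ler_pdivrMl ?ltr0n//.
rewrite mulr_natl -[X in _ *+ X]card_ord -sumr_const.
apply: ler_sum => i _.
pose f k : R := (x k != y k)%:R.
have -> : \sum_(0 <= j < N) (x (j + i)%N != y (j + i)%N)%:R = \sum_(i <= k < i + N) f k.
  by have := big_addn 0 (i + N) i xpredT f; rewrite add0n addKn => ->.
rewrite [leRHS](@big_cat_nat _ _ _ i)/= ?leq0n//
  ?(leq_trans (ltnW (ltn_ord i))) ?leq_addr//.
rewrite (@big_cat_nat _ _ _ (i + N) i (n + N))/= ?leq_addr ?leq_add2r 1?ltnW//.
by rewrite ler_wpDl ?lerDl ?sumr_ge0.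
Qed.

Variable s0 : S.

(** The default of [nth] matters: the last windows read past the word, which is continued by the
    constant letter [s0]. *)
Definition word_birkhoff N w := birkhoff_sum (mcshane phi) N (nth s0 w).

Lemma word_birkhoff_lipschitz N : hamming_lipschitz (word_birkhoff N).
Proof.
move=> u a b v; apply: le_trans (birkhoff_sum_lipschitz _ _ _) _.
apply: (@le_trans _ _ (\sum_(0 <= k < n + N) (k == size u)%:R)).
  apply: ler_sum => k _; rewrite ler_nat !nth_cat.
  by case: ltngtP => [|uk|->]; rewrite ?eqxx ?subnn ?leq_b1//
    -[(k - _)%N]prednK ?subn_gt0//= eqxx.
rewrite (eq_bigr (fun k => if k == size u then 1 else 0)); last first.
  by move=> k _; case: eqP.
by rewrite -big_mkcond big_nat1_eq; case: ifP.
Qed.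

(** Only the [n] coordinates from [N] on can differ, so the error does not grow with [N] and
    disappears after division by it. *)
Lemma birkhoff_near_word N w x : size w = N -> sft A x ->
  (forall i, (i < N)%N -> x i = nth s0 w i) ->
  `|birkhoff_sum phi N x - word_birkhoff N w| <= n%:R.
Proof.
move=> wN xA xw.
have -> : birkhoff_sum phi N x = birkhoff_sum (mcshane phi) N x.
  by apply: eq_bigr => j _; rewrite mcshane_id//; exact: sft_iter_shift.
apply: le_trans (birkhoff_sum_lipschitz _ _ _) _.
rewrite (@big_cat_nat _ _ _ N)//= ?leq_addl// big_nat big1 ?add0r; last first.
  by move=> i /xw ->; rewrite eqxx.
apply: (@le_trans _ _ (\sum_(N <= k < n + N) 1)).
  by apply: ler_sum => k _; case: (_ != _).
by rewrite sumr_const_nat addnK.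
Qed.

End McShane.

(** * Invariant measures and entropy *)

Section SimpleIntegrals.
Context d {T : measurableType d} {R : realType} (P : probability T R).

Lemma Rintegral_sum_indic (I : Type) (r : seq I) (c : I -> R) (B : I -> set T)
    (D : set T) : measurable D -> (forall i, measurable (B i)) ->
  P.-integrable D (EFin \o (fun x => \sum_(i <- r) c i * \1_(B i) x)) /\
  \int[P]_(x in D) (\sum_(i <- r) c i * \1_(B i) x) =
    \sum_(i <- r) c i * fine (P (B i `&` D)).
Proof.
move=> mD mB.
have int1 i : P.-integrable D (EFin \o \1_(B i)).
  by apply: (integrableS measurableT) => //; exact: integrable_indic.
have intc i : P.-integrable D (EFin \o (fun x => c i * \1_(B i) x)).
  by rewrite /comp; under eq_fun do rewrite EFinM; exact: (integrableZl mD _ (int1 i)).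
elim: r => [|i r [IHi IH]].
  split; last by under eq_Rintegral do rewrite big_nil;
    rewrite Rintegral_cst// mul0r big_nil.
  by rewrite /comp; under eq_fun do rewrite big_nil; exact: integrable0.
split.
  rewrite /comp; under eq_fun do rewrite big_cons EFinD.
  exact: (integrableD mD (intc i) IHi).
under eq_Rintegral do rewrite big_cons.
rewrite RintegralD// IH big_cons RintegralZl//; congr (_ * _ + _).
by rewrite /Rintegral integral_indic.
Qed.

(** The indicators of the fibres of [f] sum to the constant 1, which is then integrated over [D]. *)
Lemma measure_fiber_sum (I : finType) (f : T -> I) (D : set T) :
  measurable D -> (forall i, measurable (f @^-1` [set i])) ->
  \sum_i fine (P (f @^-1` [set i] `&` D)) = fine (P D).
Proof.
move=> mD mf.
have [_] := Rintegral_sum_indic (index_enum I) (fun=> 1) mD mf.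
under [RHS]eq_bigr do rewrite mul1r.
move=> <-; rewrite -[RHS]mul1r -Rintegral_cst//; apply: eq_Rintegral => x _.
rewrite (bigD1 (f x))//= indicE mem_set// mulr1 big1 ?addr0// => i ifx.
by rewrite indicE memNset ?mulr0// => /= fxi; rewrite fxi eqxx in ifx.
Qed.

End SimpleIntegrals.

Section InvariantMeasure.
Context {R : realType} {S : finType} (s0 : S) (A : rel S).
Variable m : probability (borel_seq s0) R.
Hypothesis m_inv : invariant_on_sft A m.
Implicit Types (u v w : seq S) (x y : nat -> S).

Let M : set (set (borel_seq s0)) := measurable.

Lemma measurable_coordinate i (a : S) : M [set x | x i = a].
Proof.
apply: sub_sigma_algebra.
rewrite (_ : [set x | x i = a] =
  @proj nat (fun=> discrete_topology S) i @^-1` [set a]); last by [].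
apply: open_comp; first by move=> x _; exact: proj_continuous.
exact: discrete_open.
Qed.

Lemma measurable_coordinate_in i (Q : set S) : M [set x | Q (x i)].
Proof.
rewrite (_ : [set x | Q (x i)] = \bigcup_(a in Q) [set x | x i = a]).
  apply: fin_bigcup_measurable => [|a _]; last exact: measurable_coordinate.
  exact: finite_finset.
by apply/seteqP; split=> [x Qx|x [a Qa xa]]; [exists (x i)|rewrite /= xa].
Qed.

Lemma measurable_shift_cylinder k w :
  M (iter k (@Defs.shift S) @^-1` seq_cylinder s0 A w).
Proof.
rewrite (_ : _ @^-1` _ =
  (\bigcap_n [set x | A (x (k + n)%N) (x (k + n).+1)]) `&`
  (\bigcap_(i in `I_(size w)) [set x | x (k + i)%N = nth s0 w i])); last first.
  apply/seteqP; split=> x.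
    move=> [xA xw]; split=> [n _|i iw] /=.
      by have := xA n; rewrite !iter_shift addnS.
    by rewrite -xw// iter_shift.
  move=> [xA xw]; split=> [n|i iw]; rewrite !iter_shift; last exact: xw.
  by rewrite addnS; exact: xA.
apply: measurableI; last first.
  by apply: bigcap_measurableType => i _; exact: measurable_coordinate.
apply: bigcapT_measurable => n.
rewrite (_ : [set x | _] = \bigcup_(a in [set: S])
  ([set x | x (k + n)%N = a] `&` [set x | A a (x (k + n).+1)])); last first.
  by apply/seteqP; split=> [x xA|x [a _ [/= <-]]] //; exists (x (k + n)%N).
apply: fin_bigcup_measurable => [|a _]; first exact: finite_finset.
apply: measurableI; first exact: measurable_coordinate.
exact: (measurable_coordinate_in _ (A a)).
Qed.

Lemma measurable_cylinder w : M (seq_cylinder s0 A w).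
Proof. exact: (measurable_shift_cylinder 0). Qed.

Lemma measurable_sft : M (sft A).
Proof.
rewrite (_ : sft A = seq_cylinder s0 A [::]); first exact: measurable_cylinder.
by apply/seteqP; split=> [x xA|x []].
Qed.

Definition word_measure w : R := fine (m (seq_cylinder s0 A w)).

Definition word n k x : n.-tuple S := [tuple x (k + i)%N | i < n].

Lemma measurable_word n k (w : n.-tuple S) : M (word n k @^-1` [set w]).
Proof.
rewrite (_ : _ @^-1` _ = \bigcap_(i in [set: 'I_n]) [set x | x (k + i)%N = tnth w i]).
  by apply: fin_bigcap_measurable => // i _; exact: measurable_coordinate.
apply/seteqP; split=> x /=.
  by move=> <- i _ /=; rewrite tnth_mktuple.
by move=> xw; apply: eq_from_tnth => i; rewrite tnth_mktuple (xw i).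
Qed.

Lemma seq_cylinder_word n k (w : n.-tuple S) x : sft A x ->
  (iter k (@Defs.shift S) @^-1` seq_cylinder s0 A w) x <-> word n k x = w.
Proof.
move=> xA; split=> [[_ xw]|<-].
  apply: eq_from_tnth => i; rewrite tnth_mktuple (tnth_nth s0) -xw ?size_tuple//.
  by rewrite iter_shift.
split; first exact: sft_iter_shift.
move=> i; rewrite size_tuple => i_n; rewrite iter_shift.
by rewrite -(tnth_nth s0 _ (Ordinal i_n)) tnth_mktuple.
Qed.

Lemma word_measure_shift k w :
  fine (m (iter k (@Defs.shift S) @^-1` seq_cylinder s0 A w)) = word_measure w.
Proof.
rewrite /word_measure; elim: k => //= k <-.
rewrite -(m_inv.2 _ (measurable_shift_cylinder k w)); congr (fine (m _)).
by apply/funext => x; rewrite /preimage /= -iterS iterSr.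
Qed.

Lemma word_measure_ge0 w : 0 <= word_measure w.
Proof. exact: fine_ge0. Qed.

Lemma word_measure_le1 w : word_measure w <= 1.
Proof.
rewrite /word_measure -lee_fin fineK ?probability_le1//; first exact: measurable_cylinder.
by rewrite fin_num_measure//; exact: measurable_cylinder.
Qed.

Lemma sum_word_measure_catl u n :
  \sum_(v : n.-tuple S) word_measure (u ++ v) = word_measure u.
Proof.
rewrite /word_measure -(measure_fiber_sum m (measurable_cylinder u)
  (@measurable_word n (size u))).
apply: eq_bigr => v _; congr (fine (m _)); rewrite seq_cylinder_cat setIC.
apply/seteqP; split=> x [h1 h2]; split=> //.
  by apply/seq_cylinder_word => //; case: h2.
by apply/(@seq_cylinder_word n) => //; case: h2.
Qed.

Lemma m_setI_sft B : M B -> fine (m (B `&` sft A)) = fine (m B).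
Proof.
move=> mB; have mA := measurable_sft.
have mAC : m (~` sft A) = 0.
  by rewrite probability_setC// m_inv.1 subee.
rewrite -[in RHS](setIT B) -(setUv (sft A)) setIUr measureU; first last.
- by rewrite setIACA setICr setI0.
- by apply: measurableI => //; exact: measurableC.
- exact: measurableI.
rewrite [X in (_ + X)%E](_ : _ = 0%E) ?adde0//.
apply/eqP; rewrite eq_le measure_ge0 andbT -mAC le_measure ?inE//.
  by apply: measurableI => //; exact: measurableC.
exact: measurableC.
Qed.

(** Invariance moves [v] to position [n], and the first [n] letters then partition the shifted
    cylinder. The intersection with [sft A] is needed since a point whose shift is admissible may
    itself not be. *)
Lemma sum_word_measure_catr n v :
  \sum_(u : n.-tuple S) word_measure (u ++ v) = word_measure v.
Proof.
rewrite -(word_measure_shift n) -m_setI_sft; last exact: measurable_shift_cylinder.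
rewrite -(measure_fiber_sum m _ (@measurable_word n 0)); last first.
  by apply: measurableI; [exact: measurable_shift_cylinder|exact: measurable_sft].
apply: eq_bigr => u _; congr (fine (m _)); rewrite seq_cylinder_cat size_tuple.
apply/seteqP; split=> x.
  move=> [xu xv]; have xA : sft A x by case: xu.
  by split=> //; apply/(@seq_cylinder_word n 0).
by move=> [xu [xv xA]]; split=> //; apply/(@seq_cylinder_word n 0).
Qed.

Lemma sum_word_measure n : \sum_(w : n.-tuple S) word_measure w = 1.
Proof.
rewrite (sum_word_measure_catl [::]) /word_measure.
rewrite (_ : seq_cylinder s0 A [::] = sft A); first by rewrite m_inv.1.
by apply/seteqP; split=> [x []|x xA].
Qed.

Definition word_entropy n : R :=
  \sum_(w : n.-tuple S) - (word_measure w * ln (word_measure w)).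

Lemma word_entropyE : entropy A m = lim ((fun n : nat => n%:R^-1 * word_entropy n) @ \oo).
Proof.
apply: (congr1 (fun h : R^nat => lim (h @ \oo))).
apply/funext => n; congr (_ * _).
by apply: eq_bigr => w _; rewrite (cylinderE s0).
Qed.

(** Nonnegativity of mutual information: the Gibbs inequality for the joint law, with [s] the
    logarithm of the product of its marginals. *)
Lemma word_entropy_subadditive k n :
  word_entropy (k + n) <= word_entropy k + word_entropy n.
Proof.
pose p (uv : k.-tuple S * n.-tuple S) := word_measure (uv.1 ++ uv.2).
pose s (uv : k.-tuple S * n.-tuple S) :=
  ln (word_measure uv.1) + ln (word_measure uv.2).
have p0 uv : 0 <= p uv by exact: word_measure_ge0.
have p1 : \sum_uv p uv = 1.
  rewrite -(sum_word_measure k) -(pair_bigA _ (fun (u : k.-tuple S) (v : n.-tuple S) =>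
      word_measure (u ++ v)))/=.
  by apply: eq_bigr => u _; exact: sum_word_measure_catl.
have := gibbs_inequality s p0 p1.
have -> : \sum_uv p uv * s uv = - word_entropy k - word_entropy n.
  under eq_bigr do rewrite /s mulrDr.
  rewrite big_split/=; congr (_ + _); rewrite /word_entropy -sumrN.
    rewrite -(pair_bigA _ (fun (u : k.-tuple S) (v : n.-tuple S) =>
      word_measure (u ++ v) * ln (word_measure u)))/=.
    by apply: eq_bigr => u _; rewrite -mulr_suml sum_word_measure_catl opprK.
  rewrite -(pair_bigA _ (fun (u : k.-tuple S) (v : n.-tuple S) =>
      word_measure (u ++ v) * ln (word_measure v)))/=.
  rewrite exchange_big/=; apply: eq_bigr => v _.
  by rewrite -mulr_suml sum_word_measure_catr opprK.
have -> : \sum_uv - (p uv * ln (p uv)) = word_entropy (k + n).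
  rewrite /word_entropy (big_tupleD _ _
    (fun w => - (word_measure w * ln (word_measure w)))).
  by rewrite pair_bigA.
(* On the support of [p] both marginals are positive, so [expR (s uv)] is their product, and the
   product law has total mass 1. *)
suff : ln (\sum_(uv | 0 < p uv) expR (s uv)) <= 0 by lra.
apply: ln_le0.
have -> : 1 = \sum_(uv : k.-tuple S * n.-tuple S) word_measure uv.1 * word_measure uv.2.
  rewrite -(pair_bigA _ (fun (u : k.-tuple S) (v : n.-tuple S) =>
      word_measure u * word_measure v))/=.
  under eq_bigr do rewrite -mulr_sumr sum_word_measure mulr1.
  by rewrite sum_word_measure.
rewrite big_mkcond; apply: ler_sum => -[u v] _; case: ifP => [puv|_]; last first.
  by rewrite mulr_ge0 ?word_measure_ge0.
have u0 : 0 < word_measure u.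
  apply: lt_le_trans puv _; rewrite /p -(sum_word_measure_catl u n) (bigD1 v)//= lerDl.
  by apply: sumr_ge0 => w _; exact: word_measure_ge0.
have v0 : 0 < word_measure v.
  apply: lt_le_trans puv _; rewrite /p -(sum_word_measure_catr k v) (bigD1 u)//= lerDl.
  by apply: sumr_ge0 => w _; exact: word_measure_ge0.
by rewrite /s expRD !lnK.
Qed.

Lemma word_entropy_cvg : cvgn (fun n : nat => n%:R^-1 * word_entropy n).
Proof.
apply: (@fekete_cvg _ _ 0) => [k n|n]; first exact: word_entropy_subadditive.
rewrite mul0r oppr0; apply: sumr_ge0 => w _.
by rewrite -mulrN mulr_ge0 ?word_measure_ge0// oppr_ge0 ln_le0// word_measure_le1.
Qed.

Variables (n : nat) (phi : (nat -> S) -> R).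
Hypothesis phi_local : forall x, sft A x -> phi x = mcshane A n phi (nth s0 (word n 0 x)).

Let c (v : n.-tuple S) := mcshane A n phi (nth s0 v).

(** On the shift [phi] depends on [n] letters only, so the Birkhoff sum is a finite combination of
    indicators of shifted cylinders, and invariance makes its [N] terms contribute equally. *)
Lemma Rintegral_birkhoff_sum N t :
  m.-integrable (sft A) (EFin \o birkhoff_sum (fun x => t * phi x) N) /\
  \int[m]_(x in sft A) birkhoff_sum (fun x => t * phi x) N x =
    N%:R * (t * \sum_v c v * word_measure v).
Proof.
pose B (jv : 'I_N * n.-tuple S) :=
  iter jv.1 (@Defs.shift S) @^-1` seq_cylinder s0 A jv.2.
have mB jv : M (B jv) by exact: measurable_shift_cylinder.
have [] := Rintegral_sum_indic m (index_enum _) (fun jv => t * c jv.2) measurable_sft mB.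
(* For each [j], a point of the shift lies in the shifted cylinder of exactly one [v], namely its
   own word at position [j]. *)
have E : {in (sft A : set (borel_seq s0)), (fun x => \sum_jv t * c jv.2 * \1_(B jv) x) =1
    birkhoff_sum (fun x => t * phi x) N}.
  move=> x /set_mem xA; rewrite /birkhoff_sum big_mkord.
  rewrite -(pair_bigA _ (fun (j : 'I_N) (v : n.-tuple S) => t * c v * \1_(B (j, v)) x))/=.
  apply: eq_bigr => j _; rewrite (bigD1 (word n j x))//= big1 ?addr0.
    rewrite indicE mem_set ?mulr1; last by apply/seq_cylinder_word.
    rewrite phi_local; last exact: sft_iter_shift.
    by congr (_ * mcshane _ _ _ (nth s0 _)); congr val; apply: eq_from_tnth => i;
      rewrite !tnth_mktuple iter_shift.
  move=> v vx; rewrite indicE memNset ?mulr0// => /(seq_cylinder_word j v xA) xv.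
  by rewrite xv eqxx in vx.
move=> B_int BE; split.
  by apply: eq_integrable B_int; [exact: measurable_sft|move=> x xA; rewrite /= E].
rewrite -(eq_Rintegral _ E) BE.
under eq_bigr do rewrite m_setI_sft// word_measure_shift.
rewrite -(pair_bigA _ (fun (j : 'I_N) (v : n.-tuple S) => t * c v * word_measure v))/=.
rewrite sumr_const card_ord.
rewrite -[LHS]mulr_natl; congr (_ * _).
by rewrite mulr_sumr; apply: eq_bigr => v _; rewrite mulrA.
Qed.

End InvariantMeasure.

(** * The pressure bound *)

Section Mixing.
Context {S : finType} (A : rel S).

Lemma transition_mx_path k (i j : 'I_#|S|) :
  (0 < (transition_mx A ^+ k) i j)%N ->
  exists2 u : k.-tuple S, path A (enum_val i) u & last (enum_val i) u = enum_val j.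
Proof.
elim: k i => [|k IH] i.
  rewrite expr0 mxE; case: eqP => [->|//] _; by exists [tuple].
rewrite exprS mxE lt0n sum_nat_eq0 negb_forall => /existsP[l].
rewrite /= -lt0n muln_gt0 => /andP[]; rewrite mxE lt0b => il /IH[u pu lu].
by exists [tuple of enum_val l :: u] => //=; rewrite il.
Qed.

Lemma mixing_path : mixing_sft A -> exists r, (0 < r)%N /\
  forall a c, exists2 u : r.-tuple S, path A a u & last a u = c.
Proof.
move=> [r [r0 A_pos]]; exists r; split=> // a c.
by have := transition_mx_path (A_pos (enum_rank a) (enum_rank c)); rewrite !enum_rankK.
Qed.

(** The power in [mixing_sft] is positive, so a path from [a] back to itself has a first step. *)
Lemma mixing_succ : mixing_sft A -> forall a, exists b, A a b.
Proof.
move=> /mixing_path[[|r] [r0 A_mix]] a //; have [u pu _] := A_mix a a.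
by move: pu; case: (tupleP u) => b u' /= /andP[ab _]; exists b.
Qed.

End Mixing.

(** * Upper and lower bounds for partition sums *)

Section FiniteEstimates.
Context {R : realType} {S : finType} (s0 : S) (A : rel S).
Hypothesis A_succ : forall a, exists b, A a b.
Implicit Types (phi psi : (nat -> S) -> R).

(** The centre [c] is chosen before [t]: the bounds at [t] and [- t] share it, so that it cancels
    when they are combined. *)
Lemma ln_partition_sum_le r (A_mix : forall a c,
    exists2 u : r.-tuple S, path A a u & last a u = c)
    n phi (N : nat) :
  (0 < n)%N -> Omega_n A n phi ->
  exists c : R, forall t, ln (partition_sum A (fun x => t * phi x) N.+1) <=
    ln #|language A N.+1|%:R + t * c +
    2 * t ^+ 2 * (2 * r%:R * #|{: r.-tuple S}|.+1%:R + 1) ^+ 2 * N%:R +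
    `|t| * (2 * r%:R * #|{: r.-tuple S}|.+1%:R + 1 + n%:R).
Proof.
move=> n0 phiL; have A0 := sft_neq0 s0 A_succ.
set K := _ * #|_|.+1%:R + 1.
pose F := word_birkhoff A n phi s0 N.+1.
exists (path_mean A N s0 (fun v => F (s0 :: v))) => t.
have FL : hamming_lipschitz F by exact: word_birkhoff_lipschitz.
have [z zA] := A0.
have phiC x : sft A x -> `|t * phi x| <= `|t| * (`|phi z| + 1).
  move=> xA; rewrite normrM ler_wpM2l//.
  have := phiL x z xA zA; have := hamming_dist_le1 (R := R) n x z.
  by have := ler_normD (phi x - phi z) (phi z); rewrite subrK; lra.
have Z0 := partition_sum_gt0 s0 A_succ phiC N.+1.
have L0 : 0 < #|language A N.+1|%:R :> R.
  rewrite -(partition_sum_zero (R := R) _ (fun=> 0)).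
  by apply: (@partition_sum_gt0 _ _ s0 _ A_succ _ 0) => x _; rewrite mulr0 normr0.
suff : partition_sum A (fun x => t * phi x) N.+1 <= #|language A N.+1|%:R *
    expR (t * path_mean A N s0 (fun v => F (s0 :: v)) + 2 * t ^+ 2 * K ^+ 2 * N%:R +
      `|t| * (K + n%:R)).
  rewrite -ler_ln ?posrE ?mulr_gt0 ?expR_gt0// lnM ?posrE ?expR_gt0// expRK.
  by rewrite !addrA.
(* Replacing the supremum over a cylinder by the value [F w] costs at most [n] in the Birkhoff
   sum. *)
have le1 : partition_sum A (fun x => t * phi x) N.+1 <=
    expR (`|t| * n%:R) * \sum_(w : N.+1.-tuple S | sorted A w) expR (t * F w).
  rewrite /partition_sum mulr_sumr.
  under [leLHS]eq_bigl do rewrite (in_language s0)//.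
  apply: ler_sum => w sw; rewrite -expRD ler_expR (cylinderE s0).
  apply: ge_sup.
    by have /(seq_cylinder_neq0 s0 A_succ)[x xw] := sw;
      exists (birkhoff_sum (fun x => t * phi x) N.+1 x), x.
  move=> _ [x [xA xw] <-].
  have -> : birkhoff_sum (fun x => t * phi x) N.+1 x = t * birkhoff_sum phi N.+1 x.
    by rewrite /birkhoff_sum mulr_sumr.
  rewrite -lerBlDr -mulrBr; apply: le_trans (ler_norm _) _.
  rewrite normrM ler_wpM2l// /F birkhoff_near_word// ?size_tuple// => i iN.
  by apply: xw; rewrite size_tuple.
apply: le_trans le1 _.
apply: le_trans (ler_wpM2l (expR_ge0 _) (word_exp_moment A_succ A_mix N s0 t FL)) _.
rewrite (_ : [set w : N.+1.-tuple S | sorted A w]%SET = language A N.+1); last first.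
  by apply/setP => w; rewrite (in_language s0)// !inE.
rewrite mulrCA -expRD ler_wpM2l ?ler0n// ler_expR -/K.
set c := path_mean _ _ _ _; set X := 2 * _ * _ * _; lra.
Qed.

Variable m : probability (borel_seq s0) R.
Hypothesis m_inv : invariant_on_sft A m.

(** The easy half of the variational principle at finite length: the integral is at most the average
    of the cylinder suprema, to which the Gibbs inequality applies. *)
Lemma word_entropy_add_Rintegral_le psi C N :
  (forall x, sft A x -> `|psi x| <= C) ->
  m.-integrable (sft A) (EFin \o birkhoff_sum psi N) ->
  word_entropy A m N + \int[m]_(x in sft A) birkhoff_sum psi N x <=
    ln (partition_sum A psi N).
Proof.
move=> psiC psi_int.
pose s (w : N.-tuple S) := sup (birkhoff_sum psi N @` seq_cylinder s0 A w).
have mA := @measurable_sft _ s0 A.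
have mcyl (w : N.-tuple S) := @measurable_cylinder _ s0 A w.
have [s_int s_eq] := Rintegral_sum_indic m (index_enum _) s mA mcyl.
have int_le : \int[m]_(x in sft A) birkhoff_sum psi N x <=
    \sum_(w : N.-tuple S) word_measure A m w * s w.
  rewrite (_ : \sum_w _ = \int[m]_(x in sft A)
    (\sum_w s w * \1_(seq_cylinder s0 A w) x)); last first.
    rewrite s_eq; apply: eq_bigr => w _;
    by rewrite (m_setI_sft m_inv (mcyl w)) mulrC.
  apply: le_Rintegral => // x xA; rewrite (bigD1 (word N 0 x))//= big1 ?addr0; last first.
    move=> w wx; rewrite indicE memNset ?mulr0// => /(seq_cylinder_word s0 0 w xA) xw.
    by rewrite xw eqxx in wx.
  have xw : seq_cylinder s0 A (word N 0 x) x by exact/(seq_cylinder_word s0 0 _ xA).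
  rewrite indicE mem_set// mulr1.
  exact: birkhoff_le_word_sup psiC _ _ _ xw.
have := gibbs_inequality s (fun w : N.-tuple S => word_measure_ge0 A m w)
  (sum_word_measure m_inv N).
rewrite -/(word_entropy A m N) => gibbs.
rewrite addrC (le_trans (lerD int_le (lexx _)))// (le_trans gibbs)//.
rewrite ler_ln ?posrE ?(partition_sum_gt0 s0 A_succ psiC)//.
  (* A word of positive measure has a nonempty cylinder, hence belongs to the language. *)
  rewrite /partition_sum big_mkcond [leRHS]big_mkcond; apply: ler_sum => w _.
  case: ifP => [pw|_]; last by case: ifP => // _; exact: expR_ge0.
  rewrite ifT ?(cylinderE s0)// inE (cylinderE s0); apply/asboolP.
  apply: contrapT => /nonemptyPn w0.
  by move: pw; rewrite /word_measure w0 measure0 ltxx.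
have [w pw|p0] := pickP (fun w : N.-tuple S => 0 < word_measure A m w).
  rewrite (bigD1 w)//= ltr_wpDr ?expR_gt0//.
  by apply: sumr_ge0 => v _; exact: expR_ge0.
have := sum_word_measure m_inv N; rewrite big1 => [/eqP|w _].
  by rewrite eq_sym oner_eq0.
by apply/eqP; rewrite eq_le word_measure_ge0 leNgt p0.
Qed.

End FiniteEstimates.

Theorem theorem3 (R : realType) (S : finType) (s0 : S) (A : rel S)
    (hA : mixing_sft A) (m : probability (borel_seq s0) R)
    (hm : max_entropy_measure A m) :
  exists M : R, 0 < M /\
    forall phi : (nat -> S) -> R, Omega A phi ->
      forall t : R,
        pressure A (fun x => t * phi x) <=
          htop A R + t * (\int[m]_(x in sft A) phi x) + M * t ^+ 2.
Proof.
have [m_inv m_max] := hm.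
have A_succ := mixing_succ hA.
have [r [_ A_mix]] := mixing_path hA.
have [z zA] := sft_neq0 s0 A_succ.
pose K : R := 2 * r%:R * #|{: r.-tuple S}|.+1%:R + 1.
have K0 : 0 < K by rewrite ltr_wpDl// !mulr_ge0.
(* Twice the coefficient [2 * K ^+ 2] of [ln_partition_sum_le], which is used at [t] and at
   [- t]. *)
exists (4 * K ^+ 2); split; first by rewrite mulr_gt0 ?exprn_gt0.
move=> phi [n n0 phiL] t.
set I := Rintegral _ _ _.
have phiC s x : sft A x -> `|s * phi x| <= `|s| * (`|phi z| + 1).
  move=> xA; rewrite normrM ler_wpM2l//.
  have := phiL x z xA zA; have := hamming_dist_le1 (R := R) n x z.
  by have := ler_normD (phi x - phi z) (phi z); rewrite subrK; lra.
have phi_local x : sft A x -> phi x = mcshane A n phi (nth s0 (word n 0 x)).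
  move=> xA; rewrite -(mcshane_id phiL (ex_intro _ z zA) xA).
  apply/eqP; rewrite -subr_eq0 -normr_le0.
  apply: le_trans (mcshane_lipschitz phiL (ex_intro _ z zA) _ _) _.
  rewrite hamming_distE big1 ?mulr0// => i _.
  by rewrite -tnth_nth tnth_mktuple eqxx.
have birkhoff_int := Rintegral_birkhoff_sum m_inv phi_local.
have IE : I = \sum_(v : n.-tuple S) mcshane A n phi (nth s0 v) * word_measure A m v.
  have [_] := birkhoff_int 1%N 1; rewrite !mul1r => <-.
  apply: eq_Rintegral => x _.
  by rewrite /birkhoff_sum big_nat1 mul1r.
have lower s N : word_entropy A m N + N%:R * (s * I) <=
    ln (partition_sum A (fun x => s * phi x) N).
  rewrite IE; have [int <-] := birkhoff_int N s.
  exact: word_entropy_add_Rintegral_le (phiC s) int.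
pose f N := N%:R^-1 * ln (partition_sum A (fun x => t * phi x) N).
pose g N : R := N%:R^-1 * ln #|language A N|%:R.
pose e N := N%:R^-1 * word_entropy A m N.
have fP : f @ \oo --> pressure A (fun x => t * phi x).
  exact: (pressure_cvg s0 A_succ (phiC t)).
have gP : g @ \oo --> htop A R.
  have := pressure_cvg s0 A_succ (phiC 0).
  by under eq_fun do rewrite partition_sum_zero.
(* Maximality of the entropy of [m] enters here. *)
have eP : e @ \oo --> htop A R.
  rewrite -m_max word_entropyE; exact: (word_entropy_cvg m_inv).
pose B := 2 * `|t| * (K + n%:R).
(* Adding the upper bounds at [t] and [- t] cancels [c]; the lower bound at [- t] then removes the
   partition sum of [- t]. The errors linear in the absolute value of [t] add up to [B]. *)
have main N : (0 < N)%N ->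
    f N <= 2 * g N - e N + (t * I + 4 * K ^+ 2 * t ^+ 2) + N%:R^-1 * B.
  case: N => // N _; have [c c_le] := ln_partition_sum_le s0 A_succ A_mix N n0 phiL.
  have := c_le t; have := c_le (- t); have := lower (- t) N.+1.
  rewrite normrN sqrrN -/K -/(K + n%:R) => h1 h2 h3.
  have N0 : 0 < N.+1%:R :> R by [].
  have -> : 2 * g N.+1 - e N.+1 + (t * I + 4 * K ^+ 2 * t ^+ 2) + N.+1%:R^-1 * B =
    N.+1%:R^-1 * (2 * ln #|language A N.+1|%:R - word_entropy A m N.+1 +
      N.+1%:R * (t * I) + 4 * K ^+ 2 * t ^+ 2 * N.+1%:R + B).
    by rewrite /g /e; field; rewrite gt_eqF.
  rewrite /f ler_wpM2l ?invr_ge0//.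
  (* The moment bound counts [N] steps, while the normalisation divides by the [N.+1] letters. *)
  have : 4 * K ^+ 2 * t ^+ 2 * N%:R <= 4 * K ^+ 2 * t ^+ 2 * N.+1%:R.
    by rewrite ler_wpM2l ?ler_nat// mulr_ge0 ?sqr_ge0// mulr_ge0 ?sqr_ge0.
  rewrite /B; lra.
have invP : (fun N : nat => N%:R^-1 : R) @ \oo --> (0 : R).
  apply/gtr0_cvgV0; last exact: cvgr_idn.
  by near=> N; rewrite ltr0n; near: N; exact: nbhs_infty_gt.
have rP : (fun N => 2 * g N - e N + (t * I + 4 * K ^+ 2 * t ^+ 2) + N%:R^-1 * B) @ \oo -->
    2 * htop A R - htop A R + (t * I + 4 * K ^+ 2 * t ^+ 2) + 0 * B.
  apply: cvgD; first apply: cvgD; first apply: cvgB => //.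
  - by apply: cvgMr.
  - exact: cvg_cst.
  - exact: cvgMl.
have := ler_cvg_to fP rP.
rewrite mul0r addr0 => H.
have -> : htop A R + t * I + 4 * K ^+ 2 * t ^+ 2 =
  2 * htop A R - htop A R + (t * I + 4 * K ^+ 2 * t ^+ 2) by ring.
apply: H; near=> N; apply: main.
by near: N; exact: nbhs_infty_gt.
Unshelve. all: by end_near. Qed.
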